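(* Let $Z$ be a separable Banach space, let $Y=Z^*$, and let $A:\ell^1\to Y$ be a bounded linear operator which is injective and weak$^*$-to-weak$^*$ continuous. Let $\mu\in[0,1)$ and a real sequence $\{\gamma_n\}_{n\in\mathbb{N}}$ be such that for each $n\in\mathbb{N}$ and each $\xi\in\ell^\infty$ with $\xi_k\in[-1,1]$ for $k\le n$ and $\xi_k=0$ for $k>n$ there exists $\eta\in Y^*$ satisfying (a) $P_nA^*\eta=\xi$, (b) $|[(I-P_n)A^*\eta]_k|\le\mu$ for all $k>n$, (c) $\|\eta\|_{Y^*}\le\gamma_n$. Let $x^\dagger\in\ell^1$. Then, with the constant $\beta=\frac{1-\mu}{1+\mu}\in(0,1]$ and the concave index function $$\varphi(t)=2\inf_{n\in\mathbb{N}}\left(\sum_{k=n+1}^\infty|x^\dagger_k|+\gamma_n t\right),\qquad t\ge 0,$$ the variational source condition $$\beta\|x-x^\dagger\|_{\ell^1}\le\|x\|_{\ell^1}-\|x^\dagger\|_{\ell^1}+\varphi(\|Ax-Ax^\dagger\|_Y)\quad\text{for all } x\in\ell^1$$ is satisfied.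
   Context: All spaces are over the real numbers; $\mathbb{N}=\{1,2,\dots\}$. $\ell^1$ is the space of absolutely summable sequences, $\ell^\infty=(\ell^1)^*$, and $\ell^1=(c_0)^*$. $P_n$ is the projection $P_nx=(x_1,\dots,x_n,0,0,\dots)$ and $[v]_k$ denotes the $k$-th component of a sequence $v$. The weak$^*$ topology on $\ell^1$ is taken with respect to the predual $c_0$, and on $Y$ with respect to the predual $Z$. $A$ is weak$^*$-to-weak$^*$ continuous if $x_n\rightharpoonup^* x_0$ in $\ell^1$ implies $Ax_n\rightharpoonup^* Ax_0$ in $Y$ (sequences). $A^*:Y^*\to\ell^\infty$ is the Banach space adjoint of $A$. An index function is a continuous and strictly increasing function $\varphi:[0,\infty)\to[0,\infty)$ with $\varphi(0)=0$. In the paper $x^\dagger$ is the (unique) solution of $Ax=y$ for a given $y\in\mathcal{R}(A)$, i.e. $y=Ax^\dagger$. *)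

(* Defs.v *)
From HB Require Import structures.
From mathcomp Require Import all_boot all_order all_algebra.
From mathcomp Require Import all_classical all_reals all_analysis.

Set Implicit Arguments.
Unset Strict Implicit.
Unset Printing Implicit Defensive.

Import Order.TTheory GRing.Theory Num.Theory.
Import numFieldNormedType.Exports.

Local Open Scope classical_set_scope.
Local Open Scope ring_scope.

Section BoundedLinear.
Context (R : realType).

Section Pred.
Context (V W : normedModType R).

Definition bounded_operator (f : V -> W) : Prop :=
  linear f /\ exists M : R, forall x, `|f x| <= M * `|x|.

Definition blin_pred : {pred V -> W} := mem [set f | bounded_operator f].

Record blin := Blin { blin_fun :> V -> W; _ : blin_fun \in blin_pred }.

HB.instance Definition _ := [isSub for blin_fun].
HB.instance Definition _ := [Choice of blin by <:].

Lemma blin_submod_closed : submod_closed blin_pred.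
Proof.
split.
  rewrite inE; split; first by move=> a x y /=; rewrite scaler0 addr0.
  by exists 0 => x; rewrite normr0 mul0r.
move=> a f g; rewrite !inE => -[lf [Mf bf]] [lg [Mg bg]]; split.
  move=> b x y; rewrite !fctE lf lg !scalerDr !scalerA (mulrC a b).
  by rewrite addrACA.
exists (`|a| * Mf + Mg) => x; rewrite !fctE (le_trans (ler_normD _ _))//.
by rewrite mulrDl lerD// normrZ -mulrA ler_wpM2l.
Qed.

HB.instance Definition _ :=
  GRing.isSubmodClosed.Build _ _ blin_pred blin_submod_closed.
HB.instance Definition _ := [SubChoice_isSubLmodule of blin by <:].

Lemma blinP (f : blin) : bounded_operator f.
Proof. by have := valP f; rewrite inE. Qed.

HB.instance Definition _ (f : blin) :=
  GRing.isLinear.Build R V W _ (blin_fun f) (proj1 (blinP f)).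

Definition blin_norm (f : blin) : R :=
  sup [set `|f x| | x in [set x : V | `|x| <= 1]].

Lemma blin_has_sup (f : blin) :
  has_sup [set `|f x| | x in [set x : V | `|x| <= 1]].
Proof.
split; first by exists `|f 0|, 0 => //=; rewrite normr0.
have [_ [M fM]] := blinP f; exists `|M| => _ [x /= x1 <-].
rewrite (le_trans (fM x))// (le_trans (ler_norm _))// normrM normr_id.
by rewrite ler_piMr.
Qed.

Lemma blin_norm_ub (f : blin) x : `|x| <= 1 -> `|f x| <= blin_norm f.
Proof. by move=> x1; apply: (sup_upper_bound (blin_has_sup f)); exists x. Qed.

Lemma blin_norm_le (f : blin) (M : R) :
  (forall x, `|x| <= 1 -> `|f x| <= M) -> blin_norm f <= M.
Proof.
move=> fM; apply: sup_le_ub; first by have [] := blin_has_sup f.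
by move=> _ [x x1 <-]; exact: fM.
Qed.

Lemma blin_normD (f g : blin) : blin_norm (f + g) <= blin_norm f + blin_norm g.
Proof.
apply: blin_norm_le => x x1; rewrite (le_trans (ler_normD _ _))//.
by rewrite lerD// blin_norm_ub.
Qed.

Lemma blin_normZ (a : R) (f : blin) : blin_norm (a *: f) = `|a| * blin_norm f.
Proof.
have le b g : blin_norm (b *: g) <= `|b| * blin_norm g.
  by apply: blin_norm_le => x x1; rewrite normrZ ler_wpM2l// blin_norm_ub.
apply/eqP; rewrite eq_le le/=; have [->|a0] := eqVneq a 0.
  rewrite normr0 mul0r (le_trans (normr_ge0 ((0 *: f : blin) 0)))//.
  by rewrite blin_norm_ub// normr0.
rewrite -ler_pdivlMl ?normr_gt0// -normfV.
by rewrite -{1}[f]scale1r -(mulVf a0) -scalerA le.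
Qed.

Lemma blin_norm_eq0 (f : blin) : blin_norm f = 0 -> f = 0.
Proof.
move=> f0; apply/val_inj/funext => x /=.
have [->|x0] := eqVneq x 0; first by rewrite linear0.
have : `|f (`|x|^-1 *: x)| <= 0.
  by rewrite -f0 blin_norm_ub// normrZ normfV normr_id mulVf// normr_eq0.
rewrite normr_le0 linearZ/= scaler_eq0 invr_eq0 normr_eq0 (negbTE x0)/=.
by move=> /eqP.
Qed.

HB.instance Definition _ :=
  Lmodule_isNormed.Build R blin blin_normD blin_normZ blin_norm_eq0.

End Pred.

Definition dual_space (V : normedModType R) : Type := blin V R^o.
HB.instance Definition _ (V : normedModType R) :=
  NormedModule.copy (dual_space V) (blin V R^o).

Section Adjoint.
Context (V W : normedModType R) (A : blin V W).

Lemma adjoint_subproof (eta : dual_space W) :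
  ((eta : W -> R^o) \o A) \in @blin_pred V R^o.
Proof.
have [_ [M etaM]] := blinP eta; have [_ [N AN]] := blinP A.
rewrite inE; split; first by move=> a x y /=; rewrite !linearP.
exists (`|M| * N) => x /=; apply: le_trans (etaM _) _.
apply: le_trans (ler_wpM2r (normr_ge0 _) (ler_norm M)) _.
by rewrite -mulrA ler_wpM2l.
Qed.

Definition adjoint (eta : dual_space W) : dual_space V :=
  Blin (adjoint_subproof eta).

End Adjoint.

End BoundedLinear.

Notation "{ 'bounded_linear' V -> W }" := (blin V W)
  (at level 0, V at level 98, W at level 99,
   format "{ 'bounded_linear'  V  ->  W }") : type_scope.

(* Sequences are indexed from 0: the k-th component (k >= 1) of v is v k.-1. *)
Section SequenceSpaces.
Context (R : realType).

Definition summable_pred : {pred nat -> R} :=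
  mem [set x : nat -> R | cvgn (series (fun k => `|x k|))].

Record ell1 := Ell1 { ell1_seq :> nat -> R; _ : ell1_seq \in summable_pred }.

HB.instance Definition _ := [isSub for ell1_seq].
HB.instance Definition _ := [Choice of ell1 by <:].

Lemma summable_submod_closed : submod_closed summable_pred.
Proof.
split.
  rewrite inE/=; apply/cvg_ex; exists 0; rewrite (_ : series _ = cst 0).
    exact: cvg_cst.
  by apply/funext => n; rewrite /series/= big1// => k _; rewrite normr0.
move=> a x y; rewrite !inE/= => cx cy.
apply: (@series_le_cvg _ _ (fun k => `|a| * `|x k| + `|y k|)).
- by [].
- by move=> k; apply: addr_ge0 => //; apply: mulr_ge0.
- by move=> k; rewrite !fctE (le_trans (ler_normD _ _))// normrM.
- exact: is_cvg_seriesD (@is_cvg_seriesZ _ _ `|a| cx) cy.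
Qed.

HB.instance Definition _ :=
  GRing.isSubmodClosed.Build _ _ summable_pred summable_submod_closed.
HB.instance Definition _ := [SubChoice_isSubLmodule of ell1 by <:].

Lemma ell1P (x : ell1) : cvgn (series (fun k => `|x k|)).
Proof. by have := valP x; rewrite inE. Qed.
Arguments ell1P : clear implicits.

Definition ell1_norm (x : ell1) : R := \big[+%R/0]_(0 <= k <oo) `|x k|.

Lemma ell1_normD (x y : ell1) : ell1_norm (x + y) <= ell1_norm x + ell1_norm y.
Proof.
rewrite /ell1_norm -(@lim_seriesD _ _ _ (ell1P x) (ell1P y)).
apply: lim_series_le => [||k]; [exact: ell1P| |exact: ler_normD].
exact: (@is_cvg_seriesD _ _ _ (ell1P x) (ell1P y)).
Qed.

Lemma ell1_normZ (a : R) (x : ell1) : ell1_norm (a *: x) = `|a| * ell1_norm x.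
Proof.
rewrite /ell1_norm -[RHS](@lim_seriesZ _ _ `|a| (ell1P x)).
congr (limn _); apply/funext => n; apply: eq_bigr => k _.
exact: normrM.
Qed.

Lemma ell1_norm_eq0 (x : ell1) : ell1_norm x = 0 -> x = 0.
Proof.
move=> x0; apply/val_inj/funext => k /=; apply/normr0_eq0/eqP.
rewrite eq_le normr_ge0 andbT -x0.
apply: le_trans (nondecreasing_cvgn_le _ (ell1P x) k.+1).
  rewrite /series/= big_nat_recr//= lerDr sumr_ge0//.
by apply/nondecreasing_seqP => n; rewrite /series/= big_nat_recr//= lerDl.
Qed.

HB.instance Definition _ :=
  Lmodule_isNormed.Build R ell1 ell1_normD ell1_normZ ell1_norm_eq0.

Definition ell_infty : set (nat -> R) :=
  [set v | exists M : R, forall k, `|v k| <= M].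

Definition c0 : set (nat -> R) := [set z | z @ \oo --> (0 : R)].

Lemma unit_seq_subproof k : (fun j => (j == k)%:R : R) \in summable_pred.
Proof.
rewrite inE/=; apply: (cvgP (1 : R)).
apply: cvg_near_cst; near=> n; rewrite /series/=.
rewrite (bigD1_seq k) ?iota_uniq//=; last first.
  by rewrite mem_index_iota/=; near: n; exact: nbhs_infty_gt.
by rewrite eqxx normr1 big1 ?addr0// => j /negbTE ->; rewrite normr0.
Unshelve. all: by end_near. Qed.

Definition unit_seq k : ell1 := Ell1 (unit_seq_subproof k).

(* The identification (ell^1)^* = ell^infty: a functional f corresponds to the
   sequence (f e_k)_k. *)
Definition dual_seq (f : dual_space ell1) : nat -> R := fun k => f (unit_seq k).

Definition proj_seq (n : nat) (v : nat -> R) : nat -> R :=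
  fun k => if (k < n)%N then v k else 0.

Definition ell1_pairing (x : ell1) (z : nat -> R) : R :=
  \big[+%R/0]_(0 <= k <oo) (x k * z k).

Definition weak_star_cvg_ell1 (x : nat -> ell1) (x0 : ell1) : Prop :=
  forall z, c0 z -> ell1_pairing (x n) z @[n --> \oo] --> ell1_pairing x0 z.

Definition weak_star_cvg_dual (Z : normedModType R)
    (y : nat -> dual_space Z) (y0 : dual_space Z) : Prop :=
  forall z : Z, (y n z : R) @[n --> \oo] --> (y0 z : R).

Definition weak_star_continuous (Z : normedModType R)
    (A : ell1 -> dual_space Z) : Prop :=
  forall (x : nat -> ell1) (x0 : ell1), weak_star_cvg_ell1 x x0 ->
    weak_star_cvg_dual (A \o x) (A x0).

End SequenceSpaces.

Definition separable (T : topologicalType) : Prop :=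
  exists2 D : set T, countable D & dense D.

Section IndexFunctions.
Context (R : realType).

(* phi is a total function on R; only its restriction to [0, +oo[ matters. *)
Definition index_function (phi : R -> R) : Prop :=
  [/\ forall t, 0 <= t -> 0 <= phi t,
      phi 0 = 0,
      {within `[0, +oo[, continuous phi} &
      {in `[0, +oo[ &, {homo phi : s t / s < t}}].

Definition concave_function (phi : R -> R) : Prop :=
  @convex_function R R^o [set t : R | 0 <= t] (fun t : R => - phi t).

End IndexFunctions.

(* The tail over the components n + 1, n + 2, and so on, starts at index n. *)
Definition rate_function (R : realType) (xdag : nat -> R) (gamma : nat -> R)
    (t : R) : R :=
  2 * inf [set (\big[+%R/0]_(n <= k <oo) `|xdag k|) + gamma n * t
          | n in [set n | (1 <= n)%N]].

(* Main.v *)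
(* Put d = x - xdag and take eta with xi the sign pattern of d on the first n
   components.  Pairing A^* eta with d bounds the head of d by
   gamma_n |A d| + mu (tail of d), and the rest is the triangle inequality on
   heads and tails separately, for each fixed n.  The function phi is an infimum
   of affine functions, hence concave; it is continuous even at 0 because the
   tails of xdag vanish, and strictly increasing because the slopes gamma_n are
   bounded away from 0. *)
Require Import Defs.
From mathcomp Require Import all_boot all_order all_algebra.
From mathcomp Require Import all_classical all_reals all_analysis.
From mathcomp Require Import lra.

Set Implicit Arguments.
Unset Strict Implicit.
Unset Printing Implicit Defensive.

Import Order.TTheory GRing.Theory Num.Theory.
Import numFieldNormedType.Exports.

Local Open Scope classical_set_scope.
Local Open Scope ring_scope.

(** * Infima of nonnegative affine functions on the half-line *)

Section InfimumOfAffineFunctions.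
Context (R : realType) (I : Type) (D : set I) (a b : I -> R).
Hypotheses (D0 : D !=set0) (a_ge0 : forall i, D i -> 0 <= a i).
Hypothesis b_ge0 : forall i, D i -> 0 <= b i.

(** Half of [rate_function], when [a] is the tail of [xdag] and [b] is [gamma]. For [t >= 0] the set
    is bounded below by 0, so [inf] is a true infimum. *)
Definition inf_affine (t : R) : R := inf [set a i + b i * t | i in D].

Lemma inf_affine_le (t : R) (i : I) :
  0 <= t -> D i -> inf_affine t <= a i + b i * t.
Proof.
move=> t0 Di; apply: ge_inf; last by exists i.
by exists 0 => _ [j Dj <-]; rewrite addr_ge0 ?a_ge0// mulr_ge0// b_ge0.
Qed.

Lemma le_inf_affine (t x : R) :
  (forall i, D i -> x <= a i + b i * t) -> x <= inf_affine t.
Proof.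
move=> xab; apply: lb_le_inf; first by have [i Di] := D0; exists (a i + b i * t), i.
by move=> _ [i Di <-]; exact: xab.
Qed.

Lemma inf_affine_adherent (t e : R) :
  0 <= t -> 0 < e -> exists2 i, D i & a i + b i * t < inf_affine t + e.
Proof.
move=> t0 e0; have [|_ [i Di <-] ?] :=
  @inf_adherent _ [set a i + b i * t | i in D] e e0.
- split; first by have [i Di] := D0; exists (a i + b i * t), i.
  by exists 0 => _ [j Dj <-]; rewrite addr_ge0 ?a_ge0// mulr_ge0// b_ge0.
- by exists i.
Qed.

Lemma inf_affine_ge0 (t : R) : 0 <= t -> 0 <= inf_affine t.
Proof.
move=> t0; apply: le_inf_affine => i Di.
by rewrite addr_ge0 ?a_ge0// mulr_ge0// b_ge0.
Qed.

(** Each affine function grows by at least [c * (t - s)], and this survives the infimum. The case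
    [c = 0] gives monotonicity, a positive [c] strict monotonicity. *)
Lemma inf_affine_increment (c s t : R) :
  (forall i, D i -> c <= b i) -> 0 <= s <= t ->
  inf_affine s + c * (t - s) <= inf_affine t.
Proof.
move=> cb /andP[s0 st]; apply: le_inf_affine => i Di.
have := inf_affine_le s0 Di.
have : c * (t - s) <= b i * (t - s) by rewrite ler_wpM2r ?subr_ge0// cb.
lra.
Qed.

Lemma inf_affine_homo (s t : R) : 0 <= s <= t -> inf_affine s <= inf_affine t.
Proof.
by move=> st; have := inf_affine_increment b_ge0 st; rewrite mul0r addr0.
Qed.

Lemma inf_affine_concave (p s t : R) : 0 <= p <= 1 -> 0 <= s -> 0 <= t ->
  p * inf_affine s + (1 - p) * inf_affine t <= inf_affine (p * s + (1 - p) * t).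
Proof.
move=> /andP[p0 p1] s0 t0; apply: le_inf_affine => i Di.
have := ler_wpM2l p0 (inf_affine_le s0 Di).
have : 0 <= 1 - p by lra.
move=> /ler_wpM2l/(_ _ _ (inf_affine_le t0 Di)).
lra.
Qed.

(** The quotients [a i / t + b i] decrease in [t], hence so does their infimum. This limits how fast
    the infimum can drop to the left of a point. *)
Lemma inf_affine_star_shaped (s t : R) :
  0 <= s <= t -> s * inf_affine t <= t * inf_affine s.
Proof.
move=> /andP[s0]; rewrite le_eqVlt => /predU1P[->//|st].
have t0 : 0 < t by exact: le_lt_trans st.
rewrite -ler_pdivrMl//; apply: le_inf_affine => i Di.
rewrite ler_pdivrMl//.
have := ler_wpM2l s0 (inf_affine_le (ltW t0) Di).
have := ler_wpM2r (a_ge0 Di) (ltW st).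
lra.
Qed.

(** One nearly optimal affine function controls the infimum from above near [t]. From below,
    monotonicity suffices to the right of [t] and star-shapedness to the left. *)
Lemma inf_affine_continuous : {within `[0, +oo[, continuous inf_affine}.
Proof.
apply/subspace_continuousP => t /=; rewrite in_itv/= andbT => t0.
apply/cvgrPdist_lt => e e0.
have [i Di it] := inf_affine_adherent t0 e0.
have upper : \forall s \near t, a i + b i * s < inf_affine t + e.
  have : a i + b i * s @[s --> t] --> a i + b i * t.
    exact: cvgD (cvg_cst _) (cvgM (cvg_cst _) cvg_id).
  by move/cvgr_lt; apply.
have lower : \forall s \near t, 0 <= s -> inf_affine t - e < inf_affine s.
  have [t_gt0|] := ltP 0 t; last first.
    move=> tle; have -> : t = 0 by apply/eqP; rewrite eq_le tle t0.
    near=> s => s0; have : inf_affine 0 <= inf_affine s.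
      by rewrite inf_affine_homo// lexx s0.
    lra.
  near=> s => s0; have [ts|st] := leP t s.
    have : inf_affine t <= inf_affine s by rewrite inf_affine_homo// t0.
    lra.
  (* After scaling by [t], the lower bound [s * inf_affine t] is continuous in [s] and exceeds the
     target at [s = t]. *)
  rewrite -(ltr_pM2l t_gt0).
  have st' : 0 <= s <= t by rewrite s0 ltW.
  apply: lt_le_trans (inf_affine_star_shaped st').
  near: s; have : s * inf_affine t @[s --> t] --> t * inf_affine t.
    exact: cvgM cvg_id (cvg_cst _).
  by move/cvgr_gt; apply; rewrite ltr_pM2l// gtrDl oppr_lt0.
rewrite near_withinE; near=> s; rewrite /= in_itv/= andbT => s0.
have := inf_affine_le s0 Di.
have : a i + b i * s < inf_affine t + e by near: s.
have : inf_affine t - e < inf_affine s by move: s0; near: s.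
rewrite ltr_norml; lra.
Unshelve. all: by end_near. Qed.

Lemma inf_affine0 :
  (forall e, 0 < e -> exists2 i, D i & a i <= e) -> inf_affine 0 = 0.
Proof.
move=> ae; apply/eqP; rewrite eq_le inf_affine_ge0// andbT.
apply/ler_addgt0Pr => e e0; rewrite add0r; have [i Di aie] := ae _ e0.
by have := inf_affine_le (lexx 0) Di; rewrite mulr0 addr0 => /le_trans; apply.
Qed.

End InfimumOfAffineFunctions.

(** The operator norm is a supremum over the closed unit ball, so [x] is rescaled to norm 1. *)
Lemma blin_bound (R : realType) (V W : normedModType R) (f : blin V W) (x : V) :
  `|f x| <= `|f| * `|x|.
Proof.
have [->|x0] := eqVneq x 0; first by rewrite linear0 !normr0 mulr0.
have nx : 0 < `|x| by rewrite normr_gt0.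
have : `|f (`|x|^-1 *: x)| <= `|f|.
  by apply: blin_norm_ub; rewrite normrZ normfV normr_id mulVf// gt_eqF.
by rewrite linearZ normrZ normfV normr_id ler_pdivrMl// mulrC.
Qed.

(** * Heads, tails and truncations in [ell1], and functionals acting on them *)

Section SummableSequences.
Context (R : realType).
Implicit Types (x : ell1 R) (f : dual_space (ell1 R)).

Definition ell1_tail x (n : nat) : R := \big[+%R/0]_(n <= k <oo) `|x k|.

(** The projection [P_n], written as a combination of unit vectors so that linear functionals
    evaluate on it termwise. *)
Definition ell1_trunc (n : nat) x : ell1 R :=
  \sum_(0 <= k < n) x k *: unit_seq R k.

Lemma ell1_sumE (I : Type) (r : seq I) (F : I -> ell1 R) (k : nat) :
  (\sum_(i <- r) F i) k = \sum_(i <- r) F i k.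
Proof. by apply: (big_morph (fun y : ell1 R => y k)). Qed.

Lemma ell1_truncE n x k : ell1_trunc n x k = if (k < n)%N then x k else 0.
Proof.
rewrite /ell1_trunc ell1_sumE; case: ifPn => kn.
  rewrite (bigD1_seq k) ?iota_uniq ?mem_index_iota//=.
  rewrite [X in X + _](_ : _ = x k); last first.
    by rewrite -[LHS]/(x k * (k == k)%:R) eqxx mulr1.
  rewrite big1 ?addr0// => j jk.
  by rewrite -[LHS]/(x j * (k == j)%:R) eq_sym (negbTE jk) mulr0.
rewrite big_nat big1// => j /= jn.
rewrite -[LHS]/(x j * (k == j)%:R) (_ : k == j = false) ?mulr0//.
by apply/negbTE; apply: contraNneq kn => ->.
Qed.

Lemma ell1_tail_cvg x (n : nat) :
  \sum_(n <= k < m) `|x k| @[m --> \oo] --> ell1_tail x n.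
Proof.
have : cvgn [sequence \sum_(n <= k < m) (fun k => `|x k|) k]_m.
  by rewrite is_cvg_series_restrict; exact: ell1P.
by [].
Qed.

Lemma ell1_normE x n : `|x| = \sum_(0 <= k < n) `|x k| + ell1_tail x n.
Proof.
apply: (cvg_lim (@Rhausdorff R)).
apply: cvg_trans (cvgD (cvg_cst _) (@ell1_tail_cvg x n)).
apply: near_eq_cvg; near=> m.
rewrite /= !fctE -big_cat_nat//=.
by near: m; exact: nbhs_infty_ge.
Unshelve. all: by end_near. Qed.

Lemma ell1_tail_ge0 x n : 0 <= ell1_tail x n.
Proof.
apply: (ler_cvg_to (cvg_cst 0) (@ell1_tail_cvg x n)).
by near=> m; rewrite sumr_ge0.
Unshelve. all: by end_near. Qed.

Lemma ell1_tail_cvg0 x : ell1_tail x n @[n --> \oo] --> (0 : R).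
Proof.
rewrite -(subrr `|x|).
have -> : ell1_tail x = fun n => `|x| - \sum_(0 <= k < n) `|x k|.
  by apply/funext => n; rewrite [in RHS](ell1_normE x n) addrC addKr.
exact: cvgB (cvg_cst _) (@ell1_tail_cvg x 0).
Qed.

Lemma ell1_norm_truncB x n : `|x - ell1_trunc n x| = ell1_tail x n.
Proof.
have E k : (x - ell1_trunc n x) k = if (k < n)%N then 0 else x k.
  rewrite -[LHS]/(x k - ell1_trunc n x k) ell1_truncE.
  by case: ifP => _; rewrite ?subrr ?subr0.
rewrite (ell1_normE _ n) big_nat big1 ?add0r; last first.
  by move=> k kn; rewrite E [(k < n)%N]kn normr0.
rewrite /ell1_tail; congr (limn _); apply/funext => m; apply: eq_big_nat => k /andP[nk _].
by rewrite E ltnNge nk.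
Qed.

(** A tail is the norm of [x - P_n x], which is linear in [x]; the triangle inequality of the norm
    applies. *)
Lemma ell1_tailB_le x y n : ell1_tail (x - y) n <= ell1_tail x n + ell1_tail y n.
Proof.
rewrite -!ell1_norm_truncB (le_trans _ (ler_normB _ _))//.
rewrite (_ : ell1_trunc n (x - y) = ell1_trunc n x - ell1_trunc n y).
  by rewrite !opprD addrACA.
apply/val_inj/funext => k /=.
rewrite -[RHS]/(ell1_trunc n x k - ell1_trunc n y k) !ell1_truncE.
by case: ifP => //; rewrite subr0.
Qed.

Lemma dual_trunc f n x :
  f (ell1_trunc n x) = \sum_(0 <= k < n) x k * dual_seq f k.
Proof. by rewrite /ell1_trunc linear_sum; apply: eq_bigr => k _; rewrite linearZ. Qed.

(** Truncations converge in norm, with error equal to the tail, and [f] is bounded. Thus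
    [dual_seq f] determines [f]. *)
Lemma dual_trunc_cvg f x : f (ell1_trunc n x) @[n --> \oo] --> (f x : R).
Proof.
apply/cvgrPdist_le => e e0.
have : `|f| * ell1_tail x n @[n --> \oo] --> `|f| * 0.
  exact: cvgM (cvg_cst _) (@ell1_tail_cvg0 x).
rewrite mulr0 => /cvgrPdist_le/(_ _ e0); apply: filterS => n.
rewrite sub0r normrN ger0_norm ?mulr_ge0 ?ell1_tail_ge0//; apply: le_trans.
by rewrite -linearB -ell1_norm_truncB; exact: blin_bound.
Qed.

(** The bound is termwise on the finite blocks from [n] to [m], and passes to the limit in [m]. *)
Lemma dual_truncB_le f n x (mu : R) :
  (forall k, (n <= k)%N -> `|dual_seq f k| <= mu) ->
  `|f x - f (ell1_trunc n x) : R| <= mu * ell1_tail x n.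
Proof.
move=> fmu.
have cl : `|f (ell1_trunc m x) - f (ell1_trunc n x) : R| @[m --> \oo]
    --> `|f x - f (ell1_trunc n x) : R|.
  by apply: cvg_norm; apply: cvgB (@dual_trunc_cvg f x) (cvg_cst _).
have cr : mu * (\sum_(n <= k < m) `|x k|) @[m --> \oo] --> mu * ell1_tail x n.
  exact: cvgM (cvg_cst _) (@ell1_tail_cvg x n).
apply: (ler_cvg_to cl cr); near=> m.
have nm : (n <= m)%N by near: m; exact: nbhs_infty_ge.
rewrite !dual_trunc [X in `|X|](sub_series_geq (fun k => x k * dual_seq f k) nm).
rewrite mulr_sumr (le_trans (ler_norm_sum _ _ _))//.
apply: ler_sum_nat => k /andP[nk _].
by rewrite normrM mulrC ler_wpM2r// fmu.
Unshelve. all: by end_near. Qed.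

End SummableSequences.

(** * The inequality for one fixed truncation level *)

Section VariationalInequality.
Context (R : realType) (Y : normedModType R) (A : blin (ell1 R) Y).
Implicit Types (x d : ell1 R) (eta : dual_space Y).

Lemma adjoint_bound eta x (g : R) :
  `|eta| <= g -> `|adjoint A eta x : R| <= g * `|A x|.
Proof.
move=> etag; have /le_trans := blin_bound eta (A x); apply.
by rewrite ler_wpM2r.
Qed.

(** The head equals [A^* eta] at [P_n d], that is [eta (A d)] minus [A^* eta] at [d - P_n d]. The
    norm of [eta] bounds the first term, the components beyond the head bound the second. *)
Lemma head_le eta d n (mu g : R) :
  (forall k, (k < n)%N -> dual_seq (adjoint A eta) k = Num.sg (d k)) ->
  (forall k, (n <= k)%N -> `|dual_seq (adjoint A eta) k| <= mu) ->
  `|eta| <= g ->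
  \sum_(0 <= k < n) `|d k| <= g * `|A d| + mu * ell1_tail d n.
Proof.
move=> vsg vmu etag.
have -> : \sum_(0 <= k < n) `|d k| = adjoint A eta (ell1_trunc n d).
  rewrite dual_trunc; apply: eq_big_nat => k /andP[_ kn].
  by rewrite vsg// mulrC normrEsg.
have := adjoint_bound d etag.
have := dual_truncB_le d vmu.
rewrite !ler_norml; lra.
Qed.

(** Let [H] and [T] be the head and tail of [x - y], and [G = g * |A (x - y)|]. The triangle
    inequality gives a right-hand side of at least [T - H + 2 G], and [H <= G + mu T] makes this at
    least [(1 - mu) / (1 + mu) * (H + T)]. *)
Lemma variational_inequality x y n (mu g : R) :
  0 <= mu -> 0 <= g ->
  \sum_(0 <= k < n) `|(x - y) k| <= g * `|A (x - y)| + mu * ell1_tail (x - y) n ->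
  (1 - mu) / (1 + mu) * `|x - y| <=
    `|x| - `|y| + 2 * (ell1_tail y n + g * `|A (x - y)|).
Proof.
move=> mu0 g0; have G0 : 0 <= g * `|A (x - y)| by rewrite mulr_ge0.
move: G0; set G := g * _ => G0 HG.
have := ell1_tailB_le x y n.
have : \sum_(0 <= k < n) `|y k| - \sum_(0 <= k < n) `|x k| <=
    \sum_(0 <= k < n) `|(x - y) k|.
  rewrite -sumrB; apply: ler_sum => k _.
  by rewrite [leRHS]distrC lerB_dist.
rewrite (ell1_normE x n) (ell1_normE y n) (ell1_normE (x - y) n).
move: HG; set H := \sum_(_ <= _ < _) `|(x - y) _|; set T := ell1_tail (x - y) n.
set X := \sum_(_ <= _ < _) `|x _|; set Y0 := \sum_(_ <= _ < _) `|y _|.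
move=> HG hH hT.
have mu1 : 0 < 1 + mu by lra.
rewrite mulrAC ler_pdivrMr//.
(* With the denominator cleared, the claim is linear in these products with [mu] and [1 + mu]. *)
have : 0 <= mu * G by rewrite mulr_ge0.
have : 0 <= (1 + mu) * (ell1_tail x n + ell1_tail y n - T).
  by rewrite mulr_ge0 ?subr_ge0// ltW.
have : 0 <= (1 + mu) * (H - (Y0 - X)) by rewrite mulr_ge0 ?subr_ge0// ltW.
clearbody X Y0 H T G.
lra.
Qed.

End VariationalInequality.

(** * The source condition for [xdag] and the properties of its rate function *)

Theorem theorem5p5 (R : realType) (Z : completeNormedModType R)
    (A : {bounded_linear ell1 R -> dual_space Z})
    (mu : R) (gamma : nat -> R) (xdag : ell1 R) :
  separable Z ->
  injective A ->
  weak_star_continuous A ->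
  0 <= mu < 1 ->
  (forall (n : nat) (xi : nat -> R), (1 <= n)%N ->
     ell_infty xi ->
     (forall k, (k < n)%N -> -1 <= xi k <= 1) ->
     (forall k, (n <= k)%N -> xi k = 0) ->
     exists eta : dual_space (dual_space Z),
       let v := dual_seq (adjoint A eta) in
       [/\ proj_seq n v = xi,
           forall k, (n <= k)%N -> `|(v - proj_seq n v) k| <= mu &
           `|eta| <= gamma n]) ->
  let beta := (1 - mu) / (1 + mu) in
  let phi := rate_function xdag gamma in
  [/\ 0 < beta <= 1,
      index_function phi,
      concave_function phi &
      forall x : ell1 R,
        beta * `|x - xdag| <= `|x| - `|xdag| + phi `|A x - A xdag|].
Proof.
move=> _ _ _ /andP[mu0 mu1] source beta phi.
(* The [eta] obtained for the sign pattern of [d] yields the head estimate; its norm also shows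
   [gamma n >= 0]. *)
have testing n (d : ell1 R) : (1 <= n)%N -> 0 <= gamma n /\
    \sum_(0 <= k < n) `|d k| <= gamma n * `|A d| + mu * ell1_tail d n.
  move=> n1; pose xi k := if (k < n)%N then Num.sg (d k) else 0.
  have xi1 k : `|xi k| <= 1.
    by rewrite /xi; case: ifP => _; rewrite ?normr0// normr_sg; case: eqP.
  have [||k nk|eta [/= Pv vmu etag]] := source n xi n1.
  - by exists 1.
  - by move=> k _; rewrite -ler_norml.
  - by rewrite /xi ltnNge nk.
  split; first exact: le_trans etag.
  apply: head_le etag => k kn.
    by have := congr1 (fun u => u k) Pv; rewrite /xi /proj_seq kn.
  have := vmu k kn; rewrite -[X in `|X|]/(dual_seq (adjoint A eta) k - _).
  by rewrite /proj_seq ltnNge kn subr0.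
pose D := [set n | (1 <= n)%N].
pose psi := inf_affine D (ell1_tail xdag) gamma.
have phiE t : phi t = 2 * psi t by [].
have D0 : D !=set0 by exists 1.
have a0 n : D n -> 0 <= ell1_tail xdag n by move=> _; exact: ell1_tail_ge0.
have g0 n : D n -> 0 <= gamma n by move=> /(testing _ 0)[].
have psi0 : psi 0 = 0.
  apply: inf_affine0 => // e e0.
  have /cvgrPdist_le/(_ _ e0) := @ell1_tail_cvg0 _ xdag.
  move=> [N _ /(_ N.+1 (leqnSn N))]; rewrite sub0r normrN.
  (* The successor is taken because levels in [D] start at 1. *)
  by move=> /(le_trans (ler_norm _)); exists N.+1.
(* The slopes are bounded below because [gamma n * `|A e_0| >= 1]. *)
have [c c0 gc] : exists2 c, 0 < c & forall n, D n -> c <= gamma n.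
  have ge1 n : D n -> 1 <= gamma n * `|A (unit_seq R 0)|.
    case: n => // n Dn; have [_] := testing n.+1 (unit_seq R 0) Dn.
    (* The level is at least 1, so the only nonzero entry of [e_0] lies in the head and the head sum
       is at least 1. *)
    have -> : ell1_tail (unit_seq R 0) n.+1 = 0.
      rewrite /ell1_tail (_ : (fun m => _) = cst 0) ?lim_cst//.
      apply/funext => m; rewrite big_nat big1// => -[|k] //= _.
      exact: normr0.
    rewrite mulr0 addr0; apply: le_trans; rewrite big_nat_recl//=.
    by rewrite normr1 lerDl sumr_ge0.
  have Ae0 : 0 < `|A (unit_seq R 0)|.
    (* If [A e_0] vanished, the bound at level 1 would read [1 <= 0]. *)
    rewrite lt_neqAle normr_ge0 andbT; apply/eqP => A0.
    by have := ge1 1 isT; rewrite -A0 mulr0 ler10.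
  exists `|A (unit_seq R 0)|^-1; first by rewrite invr_gt0.
  by move=> n /ge1; rewrite -ler_pdivrMr// div1r.
split.
- rewrite divr_gt0 ?ler_pdivrMr; lra.
- split.
  + by move=> t t0; rewrite phiE mulr_ge0// inf_affine_ge0.
  + by rewrite phiE psi0 mulr0.
  + apply/subspace_continuousP => t t0; apply: cvgM; first exact: cvg_cst.
    have /subspace_continuousP := inf_affine_continuous D0 a0 g0.
    exact.
  + move=> s t; rewrite !in_itv/= !andbT => s0 t0 st.
    rewrite !phiE ltr_pM2l//.
    have st' : 0 <= s <= t by rewrite s0 ltW.
    apply: lt_le_trans (inf_affine_increment D0 a0 g0 gc st').
    by rewrite ltrDl mulr_gt0// subr_gt0.
- move=> p s t; rewrite !inE/= => s0 t0.
  (* The abstract convex combinations are restated in real arithmetic, with weight [p] on [s]. *)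
  rewrite -[leLHS]/(- phi (p%:num * s + (1 - p%:num) * t)).
  rewrite -[leRHS]/(p%:num * - phi s + (1 - p%:num) * - phi t) !phiE.
  have p01 : 0 <= (p%:num : R) <= 1 by rewrite ge0 le1.
  have := inf_affine_concave D0 a0 g0 p01 s0 t0.
  rewrite -/psi; lra.
- move=> x; rewrite -linearB phiE.
  (* The left side is independent of the level, so the inequalities for all [n] combine into a bound
     on the infimum. *)
  have : (beta * `|x - xdag| - (`|x| - `|xdag|)) / 2 <= psi `|A (x - xdag)|.
    apply: le_inf_affine => // n Dn.
    have [gn tn] := testing n (x - xdag) Dn.
    have := variational_inequality mu0 gn tn.
    rewrite -/beta; lra.
  lra.
Qed.
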